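(* Let $G$ be a countable sofic group acting continuously on a compact metrizable space $X$, and let $\Sigma=\{\sigma_i:G\to\mathrm{Sym}(d_i)\}_{i=1}^\infty$ be a sofic approximation sequence for $G$. Let $\mathcal S=\{p_n\}_{n=1}^\infty$ and $\mathcal T=\{q_n\}_{n=1}^\infty$ be dynamically generating sequences in the unit ball of $C_{\mathbb R}(X)$. Then $h_\Sigma(\mathcal T)=h_\Sigma(\mathcal S)$.
   Context: **Sofic approximations.** $\mathrm{Sym}(d)$ is the permutation group of $\{1,\dots,d\}$. A sofic approximation sequence for a countable discrete group $G$ is a sequence of maps (not necessarily homomorphisms) $\sigma_i:G\to\mathrm{Sym}(d_i)$, $s\mapsto\sigma_{i,s}$, with $\lim_i d_i=\infty$, $\lim_i \frac1{d_i}|\{k:\sigma_{i,st}(k)=\sigma_{i,s}\sigma_{i,t}(k)\}|=1$ for all $s,t\in G$, and $\lim_i\frac1{d_i}|\{k:\sigma_{i,s}(k)\ne\sigma_{i,t}(k)\}|=1$ for all distinct $s,t\in G$. $G$ is sofic if maps with the last two properties exist. For a map $\sigma:G\to\mathrm{Sym}(d)$, $s\in G$ and $f\in\mathbb C^d\cong C(\{1,\dots,d\})$ put $\sigma_s(f)=f\circ\sigma_s^{-1}$; on $\mathbb C^d$, $\|f\|_2=(\frac1d\sum_k|f(k)|^2)^{1/2}$. For a pseudometric space $(Y,\rho)$ and $\varepsilon\ge0$, $N_\varepsilon(Y,\rho)$ is the maximal cardinality of a finite $\varepsilon$-separated subset of $Y$ (pairwise distances $>\varepsilon$). Convention: $\log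 0=-\infty$. **Topological setting.** For $f\in C(X)$, $\alpha_s(f)(x)=f(s^{-1}x)$. $C_{\mathbb R}(X)$ denotes the real-valued continuous functions with the supremum norm. A subset of $C(X)$ (or a sequence, via its image) is dynamically generating if it is not contained in any proper $G$-invariant unital $C^*$-subalgebra of $C(X)$. **Entropy of a sequence.** For a sequence $\mathcal S=\{p_n\}$ in the unit ball of $C_{\mathbb R}(X)$ put $\rho_{\mathcal S}(\varphi,\psi)=\sum_{n=1}^\infty2^{-n}\|\varphi(p_n)-\psi(p_n)\|_2$. For nonempty finite $F\subseteq G$, $\delta>0$ and $\sigma:G\to\mathrm{Sym}(d)$, $\mathrm{Hom}(\mathcal S,F,\delta,\sigma)$ is the set of unital (algebra) homomorphisms $\varphi:C(X)\to\mathbb C^d$ such that $\sum_{n=1}^\infty2^{-n}\|\varphi\circ\alpha_s(p_n)-\sigma_s\circ\varphi(p_n)\|_2<\delta$ for all $s\in F$. Define $h_\Sigma(\mathcal S)=\sup_{\varepsilon>0}\inf_F\inf_{\delta>0}\limsup_{i\to\infty}\frac1{d_i}\log N_\varepsilon(\mathrm{Hom}(\mathcal S,F,\delta,\sigma_i),\rho_{\mathcal S})$, where $F$ ranges over nonempty finite subsets of $G$. *)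

(* Defs.v *)
From HB Require Import structures.
From mathcomp Require Import all_boot all_order all_fingroup all_algebra.
From mathcomp Require Import all_classical all_reals all_analysis.
From mathcomp Require Import complex.

Set Implicit Arguments.
Unset Strict Implicit.
Unset Printing Implicit Defensive.

Import Order.TTheory GRing.Theory Num.Theory.
Import numFieldNormedType.Exports.

Local Open Scope classical_set_scope.
Local Open Scope ring_scope.
Local Open Scope complex_scope.

HB.instance Definition _ (R : realType) := NormedModule.copy R[i] R[i]^o.

(* C(X) is [continuousType X R[i]], made a commutative ring and an
   R[i]-module as a substructure of [X -> R[i]]. The library's algebra
   structures require 1 != 0, which fails when X is empty. *)
Section ContinuousFunctionAlgebra.
Variables (R : realType) (X : topologicalType).
Notation CX := (continuousType X R[i]).

Definition cts : {pred X -> R[i]} := fun f => `[< continuous f >].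

Section Sub.
Variables (f : X -> R[i]) (fP : f \in cts).
Definition cfun_Sub : CX := mkcts (asboolW fP).
End Sub.

Lemma cfun_rect (K : CX -> Type) :
  (forall f (Pf : f \in cts), K (cfun_Sub Pf)) -> forall u : CX, K u.
Proof.
move=> Ksub u.
have uP : (u : X -> R[i]) \in cts by apply/asboolP; exact: cts_fun.
suff -> : u = cfun_Sub uP by exact: Ksub.
exact/continuousEP.
Qed.

Lemma cfun_valP f (Pf : f \in cts) : cfun_Sub Pf = f :> (_ -> _).
Proof. by []. Qed.

HB.instance Definition _ := isSub.Build _ cts CX cfun_rect cfun_valP.

Lemma cts_subring_closed : subring_closed cts.
Proof.
split=> [|f g|f g].
- by apply/asboolP; exact: cst_continuous.
- move=> /asboolP cf /asboolP cg; apply/asboolP => x.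
  exact: (continuousB (cf x) (cg x)).
- move=> /asboolP cf /asboolP cg; apply/asboolP => x.
  exact: (continuousM (cf x) (cg x)).
Qed.

HB.instance Definition _ := GRing.isSubringClosed.Build _ cts
  cts_subring_closed.

HB.instance Definition _ := GRing.SubChoice_isSubComPzRing.Build _ cts CX
  (subringClosedP _).

Lemma cts_scaler_closed : scaler_closed cts.
Proof.
move=> c f /asboolP cf; apply/asboolP => x.
have cc : {for x, continuous (cst c : X -> R[i])} by exact: cst_continuous.
exact: (continuousM cc (cf x)).
Qed.

HB.instance Definition _ := GRing.isScaleClosed.Build _ _ cts
  cts_scaler_closed.

HB.instance Definition _ := [SubZmodule_isSubLmodule of CX by <:].

End ContinuousFunctionAlgebra.

Section ComplexConjugation.
Variable R : realType.

Lemma conjc_continuous : continuous (@conjc R : R[i] -> R[i]).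
Proof.
move=> z; apply/(@cvgrPdist_lt _ R[i] _ (nbhs z) (nbhs_filter z)) => e e0.
apply: filterS (nbhsx_ballx z e e0) => w.
by rewrite -rmorphB normcJ.
Qed.

HB.instance Definition _ :=
  isContinuous.Build R[i] R[i] (@conjc R) conjc_continuous.

End ComplexConjugation.

Section FunctionAlgebra.
Variables (R : realType) (X : topologicalType).
Notation CX := (continuousType X R[i]).

Definition metrizable : Prop := exists dist : X -> X -> R,
  [/\ forall x y, 0 <= dist x y,
      forall x y, dist x y = 0 <-> x = y,
      forall x y, dist x y = dist y x,
      forall x y z, dist x z <= dist x y + dist y z
    & forall x (A : set X), nbhs x A <->
        exists2 e : R, 0 < e & [set y | dist x y < e] `<=` A].

Definition conjf (f : CX) : CX := @conjc R \o f.

Definition supnorm (f : CX) : R := sup [set Normc.normc (f x) | x in [set: X]].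

Definition real_unit_ball : set CX :=
  [set f : CX | (forall x, f x \is Num.real) /\ supnorm f <= 1].

Definition unital_Cstar_subalgebra (A : set CX) : Prop :=
  [/\ A 1,
      forall (c : R[i]) f g, A f -> A g -> A (c *: f + g),
      forall f g, A f -> A g -> A (f * g),
      forall f, A f -> A (conjf f)
    & forall f : CX, (forall e : R, 0 < e -> exists2 g, A g & supnorm (f - g) < e) ->
        A f].

Definition unital_hom (d : nat) (phi : CX -> 'I_d -> R[i]) : Prop :=
  linear phi /\ monoid_morphism phi.

End FunctionAlgebra.

Section Dynamics.
Variables (R : realType) (G : groupType) (X : topologicalType).
Notation CX := (continuousType X R[i]).

Definition continuous_action (act : G -> continuousType X X) : Prop :=
  (forall x, act 1%g x = x) /\
  (forall s t x, act (s * t)%g x = act s (act t x)).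

Definition alpha (act : G -> continuousType X X) (s : G) (f : CX) : CX :=
  f \o act (s^-1)%g.

Definition dynamically_generating (act : G -> continuousType X X)
    (D : set CX) : Prop :=
  forall A : set CX, unital_Cstar_subalgebra A ->
    (forall s f, A f -> A (alpha act s f)) -> D `<=` A -> A = [set: CX].

End Dynamics.

Section SoficApproximation.
Variables (R : realType) (G : groupType).

(* The product of ['S_n] composes left to right, hence the explicit
   composition sigma_s (sigma_t k). *)
Definition asymp_multiplicative (d : nat -> nat)
    (sigma : forall i, G -> 'S_(d i)) : Prop :=
  forall s t : G,
    (fun i => #|[pred k | sigma i (s * t)%g k == sigma i s (sigma i t k)]|%:R
              / (d i)%:R : R) @ \oo --> (1 : R).

Definition asymp_free (d : nat -> nat)
    (sigma : forall i, G -> 'S_(d i)) : Prop :=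
  forall s t : G, s <> t ->
    (fun i => #|[pred k | sigma i s k != sigma i t k]|%:R
              / (d i)%:R : R) @ \oo --> (1 : R).

Definition sofic_approximation (d : nat -> nat)
    (sigma : forall i, G -> 'S_(d i)) : Prop :=
  [/\ d @ \oo --> \oo, asymp_multiplicative sigma & asymp_free sigma].

Definition sofic : Prop :=
  exists (d : nat -> nat) (sigma : forall i, G -> 'S_(d i)),
    asymp_multiplicative sigma /\ asymp_free sigma.

End SoficApproximation.

Section Entropy.
Variable R : realType.
Local Open Scope ereal_scope.

Definition max_separated (T : Type) (eps : R) (Y : set T)
    (rho : T -> T -> \bar R) : \bar R :=
  ereal_sup [set n%:R%:E | n in [set n | exists A : set T,
    [/\ A `<=` Y, (A #= `I_n)%card
      & forall x y, A x -> A y -> x <> y -> eps%:E < rho x y]]].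

Definition norm2 (d : nat) (f : 'I_d -> R[i]) : R :=
  Num.sqrt (d%:R^-1 * \sum_(k < d) Normc.normc (f k) ^+ 2)%R.

Definition perm_act (d : nat) (s : 'S_d) (f : 'I_d -> R[i]) : 'I_d -> R[i] :=
  f \o (s^-1)%g.

Variables (G : groupType) (X : topologicalType).
Notation CX := (continuousType X R[i]).

(* Sequences are indexed from 0, so the n-th term has weight 2^-(n+1). The
   sums of nonnegative terms are taken in the extended reals. *)
Definition rho (p : nat -> CX) (d : nat) (phi psi : CX -> 'I_d -> R[i])
    : \bar R :=
  \sum_(0 <= n <oo) (2^-1 ^+ n.+1 * norm2 (phi (p n) - psi (p n)))%:E.

Definition approx_hom (act : G -> continuousType X X) (p : nat -> CX) (F : set G)
    (delta : R) (d : nat) (sigma : G -> 'S_d) : set (CX -> 'I_d -> R[i]) :=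
  [set phi | unital_hom phi /\ forall s, F s ->
    \sum_(0 <= n <oo) (2^-1 ^+ n.+1 *
      norm2 (phi (alpha act s (p n)) - perm_act (sigma s) (phi (p n))))%:E
    < delta%:E].

Definition sofic_entropy (act : G -> continuousType X X) (d : nat -> nat)
    (sigma : forall i, G -> 'S_(d i)) (p : nat -> CX) : \bar R :=
  ereal_sup [set
    ereal_inf [set
      ereal_inf [set
        limn_esup (fun i => ((d i)%:R^-1)%:E *
          lne (max_separated eps (approx_hom act p F delta (sigma i))
                             (@rho p (d i))))
      | delta in [set delta : R | (0 < delta)%R]]
    | F in [set F : set G | finite_set F /\ F !=set0]]
  | eps in [set eps : R | (0 < eps)%R]].

End Entropy.

(* Main.v *)
Require Import Defs.
From mathcomp Require Import all_boot all_order all_fingroup all_algebra.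
From mathcomp Require Import all_classical all_reals all_analysis.
From mathcomp Require Import complex.
From mathcomp Require Import ring lra.

(** The pairs (i, phi) with phi in Hom(p, F, delta, sigma_i) form a filter base
    as F grows, delta shrinks and i is taken large; the resulting filter is
    [approx_filter p].

    The engine is [asymp_equalizer_Cstar]: if Th and Th' are two families of
    unital homomorphisms C(X) -> C^d indexed by a filtered set, then the f with
    norm2 (Th f - Th' f) -> 0 form a unital C*-subalgebra of C(X). For this
    one needs that a unital homomorphism phi is contractive and preserves
    conjugation, which follows from spectra: phi f k is a value of f, since
    otherwise f - phi f k would be invertible and yet be sent to a tuple that
    vanishes at k.

    Let p be dynamically generating. Taking Th = phi o alpha_s and
    Th' = sigma_s o phi, one gets a C*-subalgebra that contains every p_n by
    the definition of Hom(p, F, delta, sigma_i), and whose intersection over s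
    is G-invariant because sigma is asymptotically multiplicative. So it is
    C(X): along [approx_filter p] every f in C(X), and not only the p_n, is
    moved equivariantly ([approx_filter_equivariant]). Hence
    Hom(p, F, delta, sigma_i) is contained in Hom(q, F', delta', sigma_i) for
    suitable F, delta and all large i, for any sequence q in the unit ball
    ([approx_filter_approx_hom]). Taking Th = phi and Th' = psi along the pairs
    with rho_p(phi, psi) -> 0 ([close_filter p]), one gets likewise that
    rho_q(phi, psi) -> 0 ([close_filter_rho]).

    If q is dynamically generating too, the first fact with p and q exchanged
    puts Hom(q, F, delta, sigma_i) inside Hom(p, F', delta', sigma_i), and the
    second says that an eps-separated set for rho_q in it is eps'-separated for
    rho_p, with eps' depending on eps only. So the entropy of q is at most that
    of p ([sofic_entropy_le]), and the theorem follows by symmetry. *)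

Set Implicit Arguments.
Unset Strict Implicit.
Unset Printing Implicit Defensive.

Import Order.TTheory GRing.Theory Num.Theory.
Import numFieldNormedType.Exports.

Local Open Scope classical_set_scope.
Local Open Scope ring_scope.
Local Open Scope complex_scope.

(** * The modulus of a complex number *)

Section Modulus.
Variable R : realType.
Implicit Types z w : R[i].
Notation normc := (@Normc.normc R).

Lemma normr_normc z : `|z| = (normc z)%:C.
Proof. by rewrite normc_def; case: z. Qed.

Lemma normc_ge0 z : 0 <= normc z.
Proof. by case: z => x y; exact: sqrtr_ge0. Qed.

Lemma normcD_le z w : normc (z + w) <= normc z + normc w.
Proof. by have := ler_normD z w; rewrite !normr_normc -rmorphD lecR. Qed.

Lemma normc_opp z : normc (- z) = normc z.
Proof. by have := normrN z; rewrite !normr_normc => /complexI. Qed.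

Lemma normc_conj z : normc (conjc z) = normc z.
Proof. by have := normcJ z; rewrite !normr_normc => /complexI. Qed.

Lemma mul_conjc z : z * conjc z = (normc z ^+ 2)%:C.
Proof. by rewrite -sqr_normc normr_normc rmorphXn. Qed.

(** At z = f x this is the value at x of the function used in
    [unital_hom_conj]. *)
Lemma sqr_dist_sum z a b :
  (z - a) * (conjc z - conjc a) + (conjc z - b) * (z - conjc b) =
  (normc (z - a) ^+ 2 + normc (conjc z - b) ^+ 2)%:C.
Proof. by rewrite rmorphD /= -!mul_conjc !rmorphB /= conjcK. Qed.

Lemma normc_continuous : continuous normc.
Proof.
move=> z; apply/(@cvgrPdist_lt _ R _ (nbhs z) (nbhs_filter z)) => e e0.
have eC0 : 0 < e%:C by rewrite ltcR.
apply: filterS (nbhsx_ballx z e%:C eC0) => w.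
rewrite -ball_normE /= => zw.
have {zw} : normc (z - w) < e by rewrite -ltcR -normr_normc.
apply: le_lt_trans; rewrite ler_norml; apply/andP; split.
  rewrite lerNl opprB lerBlDr -[normc (z - w)]normc_opp opprB.
  by rewrite -{1}(subrK z w); exact: normcD_le.
by rewrite lerBlDr -{1}(subrK w z); exact: normcD_le.
Qed.

End Modulus.

(** * Unital homomorphisms from C(X) to C^d *)

Section UnitalHom.
Variables (R : realType) (X : topologicalType).
Notation CX := (continuousType X R[i]).
Notation normc := (@Normc.normc R).
Implicit Types f g : CX.

Lemma cfunDE f g x : (f + g) x = f x + g x. Proof. by []. Qed.

Lemma cfunBE f g x : (f - g) x = f x - g x. Proof. by []. Qed.

Lemma cfunME f g x : (f * g) x = f x * g x. Proof. by []. Qed.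

Lemma cfunZE (c : R[i]) f x : (c *: f) x = c * f x. Proof. by []. Qed.

Lemma cfun1E x : (1 : CX) x = 1. Proof. by []. Qed.

Lemma conjfE f x : conjf f x = conjc (f x). Proof. by []. Qed.

Lemma normc_le_supnorm f x : compact [set: X] -> normc (f x) <= supnorm f.
Proof.
move=> cX; apply: ub_le_sup; last by exists x.
have [] // : has_sup [set normc (f y) | y in [set: X]].
apply: compact_has_sup; first by exists (normc (f x)), x.
apply: continuous_compact => //; apply: continuous_subspaceT => y.
by apply: continuous_comp; [exact: cts_fun|exact: normc_continuous].
Qed.

Lemma supnorm_ge0 f : compact [set: X] -> 0 <= supnorm f.
Proof.
move=> cX; have [[x _]|X0] := pselect ([set: X] !=set0).
  exact: le_trans (normc_ge0 _) (normc_le_supnorm f x cX).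
suff E : [set normc (f x) | x in [set: X]] = set0 by rewrite /supnorm E sup0.
by apply/seteqP; split=> // r [x _ _]; apply: X0; exists x.
Qed.

Variables (d : nat) (phi : CX -> 'I_d -> R[i]).
Hypothesis phiH : unital_hom phi.

Lemma unital_homL (c : R[i]) f g k : phi (c *: f + g) k = c * phi f k + phi g k.
Proof. by rewrite phiH.1. Qed.

Lemma unital_hom1 k : phi 1 k = 1.
Proof. by rewrite (fst phiH.2). Qed.

Lemma unital_homM f g k : phi (f * g) k = phi f k * phi g k.
Proof. by rewrite (snd phiH.2). Qed.

Lemma unital_hom0 k : phi 0 k = 0.
Proof.
have := unital_homL (-1) 0 0 k; rewrite scaler0 addr0 mulN1r addNr.
by [].
Qed.

Lemma unital_homZ (c : R[i]) f k : phi (c *: f) k = c * phi f k.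
Proof. by rewrite -[c *: f]addr0 unital_homL unital_hom0 addr0. Qed.

Lemma unital_homD f g k : phi (f + g) k = phi f k + phi g k.
Proof. by rewrite -[f]scale1r unital_homL scale1r mul1r. Qed.

Lemma unital_homB f g k : phi (f - g) k = phi f k - phi g k.
Proof. by rewrite -scaleN1r unital_homD unital_homZ mulN1r. Qed.

Lemma unital_homC (c : R[i]) f k : phi (f - c *: (1 : CX)) k = phi f k - c.
Proof. by rewrite unital_homB unital_homZ unital_hom1 mulr1. Qed.

(** Otherwise f - phi f k is invertible, its inverse being continuous. *)
Lemma unital_hom_range f k : exists x, f x = phi f k.
Proof.
apply: contrapT => nf; set c := phi f k.
have nz x : f x - c != 0.
  by rewrite subr_eq0; apply/eqP => fx; apply: nf; exists x.
have ginv : continuous (fun x => (f x - c)^-1).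
  move=> x; apply: (@cvgV R[i] X _ _ (fun y => f y - c) _ (nz x)).
  exact: (continuousB (@cts_fun _ _ f x) (@cst_continuous _ _ c x)).
pose g : CX := mkcts ginv.
have fg : (f - c *: (1 : CX)) * g = 1.
  apply/continuousEP => x.
  by rewrite cfunME cfunBE cfunZE cfun1E mulr1 mulfV.
have := unital_hom1 k; rewrite -fg unital_homM unital_homC subrr mul0r => /eqP.
by rewrite eq_sym oner_eq0.
Qed.

Lemma unital_hom_norm_le f k : compact [set: X] -> normc (phi f k) <= supnorm f.
Proof.
by move=> cX; have [x <-] := unital_hom_range f k; exact: normc_le_supnorm.
Qed.

(** A function h killed by phi at k vanishes at some point x. With h equal to
    |f - a|^2 + |conj f - b|^2, where a and b are the k-th coordinates of phi f
    and phi (conj f), this gives f x = a and conj (f x) = b. *)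
Lemma unital_hom_conj f k : phi (conjf f) k = conjc (phi f k).
Proof.
set a := phi f k; set b := phi (conjf f) k.
pose h := (f - a *: (1 : CX)) * (conjf f - conjc a *: (1 : CX))
        + (conjf f - b *: (1 : CX)) * (f - conjc b *: (1 : CX)).
have [x] := unital_hom_range h k.
rewrite /h unital_homD !unital_homM !unital_homC !subrr mul0r mul0r addr0.
rewrite cfunDE !cfunME !cfunBE !cfunZE cfun1E conjfE !mulr1 sqr_dist_sum.
move=> /eqP; rewrite (inj_eq (@complexI R)) paddr_eq0 ?sqr_ge0// !sqrf_eq0.
by case/andP => /eqP/Normc.eq0_normc/subr0_eq <- /eqP/Normc.eq0_normc/subr0_eq <-.
Qed.

End UnitalHom.

(** * The normalized l^2 norm *)

Section MeanSquareNorm.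
Variable R : realType.
Notation normc := (@Normc.normc R).

Lemma tupleBE d (f g : 'I_d -> R[i]) k : (f - g) k = f k - g k.
Proof. by []. Qed.

Lemma norm2_ge0 d (f : 'I_d -> R[i]) : 0 <= norm2 f.
Proof. exact: sqrtr_ge0. Qed.

Lemma sqr_norm2 d (f : 'I_d -> R[i]) :
  norm2 f ^+ 2 = d%:R^-1 * \sum_(k < d) normc (f k) ^+ 2.
Proof.
by rewrite sqr_sqrtr// mulr_ge0 ?invr_ge0 ?ler0n// sumr_ge0// => k _; exact: sqr_ge0.
Qed.

Lemma norm2_le d (f : 'I_d -> R[i]) (c : R) : 0 <= c ->
  d%:R^-1 * \sum_(k < d) normc (f k) ^+ 2 <= c ^+ 2 -> norm2 f <= c.
Proof. by move=> c0; rewrite -sqr_norm2 ler_pXn2r// nnegrE// norm2_ge0. Qed.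

Lemma norm2_le_cst d (f : 'I_d -> R[i]) (c : R) : 0 <= c ->
  (forall k, normc (f k) <= c) -> norm2 f <= c.
Proof.
move=> c0 fc; apply: norm2_le => //.
have [->|d0] := eqVneq d%:R (0 : R); first by rewrite invr0 mul0r sqr_ge0.
rewrite -[leRHS](mulKf d0) ler_wpM2l ?invr_ge0 ?ler0n//.
apply: (@le_trans _ _ (\sum_(k < d) c ^+ 2)).
  by apply: ler_sum => k _; rewrite lerXn2r// nnegrE// normc_ge0.
by rewrite sumr_const card_ord mulr_natl.
Qed.

(** A substitute for the triangle inequality of [norm2], which loses a factor 2
    but also serves for products of bounded tuples. *)
Lemma norm2_dom d (h f g : 'I_d -> R[i]) (a b : R) : 0 <= a -> 0 <= b ->
  (forall k, normc (h k) <= a * normc (f k) + b * normc (g k)) ->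
  norm2 h <= 2 * (a * norm2 f) + 2 * (b * norm2 g).
Proof.
move=> a0 b0 hfg.
have c0 : 0 <= 2 * (a * norm2 f) + 2 * (b * norm2 g).
  by rewrite addr_ge0// mulr_ge0// mulr_ge0// norm2_ge0.
apply: norm2_le => //.
(* (x + y)^2 <= 2 x^2 + 2 y^2, coordinate by coordinate *)
apply: (@le_trans _ _ (2 * a ^+ 2 * norm2 f ^+ 2 + 2 * b ^+ 2 * norm2 g ^+ 2)).
  rewrite !sqr_norm2 ![_ * (d%:R^-1 * _)]mulrCA -mulrDr.
  rewrite ler_wpM2l ?invr_ge0 ?ler0n// !mulr_sumr -big_split /=.
  apply: ler_sum => k _.
  apply: (@le_trans _ _ ((a * normc (f k) + b * normc (g k)) ^+ 2)).
    rewrite lerXn2r// nnegrE ?normc_ge0//.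
    exact: le_trans (normc_ge0 _) (hfg k).
  have := sqr_ge0 (a * normc (f k) - b * normc (g k)); nra.
have := mulr_ge0 a0 (norm2_ge0 f); have := mulr_ge0 b0 (norm2_ge0 g).
nra.
Qed.

Lemma norm2_perm_act d (s : 'S_d) (f : 'I_d -> R[i]) :
  norm2 (perm_act s f) = norm2 f.
Proof.
rewrite /norm2 (reindex_inj (@perm_inj _ s)) /=.
by under eq_bigr do rewrite /perm_act /= permK.
Qed.

(** If st agrees with s o t on most points, then it acts almost like s o t:
    after reindexing by s o t, only the points of disagreement contribute, each
    by at most (2 c)^2. *)
Lemma perm_act_defect d (st s t : 'S_d) (f : 'I_d -> R[i]) (c : R) : 0 <= c ->
  (forall k, normc (f k) <= c) ->
  norm2 (perm_act st f - perm_act s (perm_act t f)) ^+ 2 <=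
  (1 - #|[pred k | st k == s (t k)]|%:R / d%:R) * (2 * c) ^+ 2.
Proof.
move=> c0 fc; set A := #|_|.
have Ad : (A <= d)%N by rewrite -[X in (_ <= X)%N]card_ord max_card.
rewrite sqr_norm2 (reindex_inj (@perm_inj _ (t * s)%g)) /=.
have dI : 0 <= (d%:R^-1 : R) by rewrite invr_ge0.
apply: (@le_trans _ _ (d%:R^-1 * \sum_(k < d | st k != s (t k)) (2 * c) ^+ 2)).
  rewrite ler_wpM2l// [leRHS]big_mkcond /=; apply: ler_sum => k _.
  rewrite tupleBE /perm_act /= permM !permK.
  have [<-|_] /= := eqVneq (st k) (s (t k)).
    by rewrite permK subrr Normc.normc0 expr0n.
  rewrite lerXn2r ?nnegrE ?normc_ge0 ?mulr_ge0//.
  apply: le_trans (normcD_le _ _) _; rewrite normc_opp.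
  have := fc k; have := fc ((st^-1)%g (s (t k))); lra.
rewrite sumr_const mulrnAr -mulrnAl ler_wpM2r ?sqr_ge0//.
have -> : #|[pred k | st k != s (t k)]| = (d - A)%N.
  by rewrite -[X in (X - _)%N]card_ord -(cardC [pred k | st k == s (t k)]) addKn.
have [d0|d0] := eqVneq d%:R (0 : R).
  by rewrite d0 invr0 mul0rn mulr0 subr0.
by rewrite -mulr_natr natrB// mulrBr mulVf// mulrC.
Qed.

End MeanSquareNorm.

(** * Families of tuples along a filter *)

Section AsymptoticallyNull.
Variables (R : realType) (T : Type) (F : set_system T) (FF : Filter F).
Variable d : T -> nat.
Notation normc := (@Normc.normc R).
Notation family := (forall w, 'I_(d w) -> R[i]).

(** The family u of tuples, whose lengths may vary with the index, tends to 0
    in [norm2] along F. *)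
Definition asymp_null (u : family) : Prop :=
  forall e : R, 0 < e -> \forall w \near F, norm2 (u w) < e.

Lemma asymp_null_dom (u v h : family) (a b : R) : 0 <= a -> 0 <= b ->
  asymp_null u -> asymp_null v ->
  (\forall w \near F, forall k,
     normc (h w k) <= a * normc (u w k) + b * normc (v w k)) ->
  asymp_null h.
Proof.
move=> a0 b0 u0 v0 huv e e0.
have c0 : 0 < 2 * (a + b + 1) by lra.
pose e' := e / (2 * (a + b + 1)).
have e'0 : 0 < e' by exact: divr_gt0.
have ee' : e = 2 * (a + b + 1) * e' by rewrite mulrC divfK// gt_eqF.
apply: filterS3 (u0 _ e'0) (v0 _ e'0) huv => w uw vw huvw.
apply: le_lt_trans (norm2_dom a0 b0 huvw) _.
have := ler_wpM2l a0 (ltW uw); have := ler_wpM2l b0 (ltW vw).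
rewrite ee'; nra.
Qed.

Lemma asymp_nullN (u v : family) :
  asymp_null (fun w => u w - v w) -> asymp_null (fun w => v w - u w).
Proof.
move=> uv; apply: (asymp_null_dom ler01 (lexx 0) uv uv).
by apply: nearW => w k; rewrite !tupleBE mul1r mul0r addr0 -normc_opp opprB.
Qed.

Lemma asymp_null_perm (u v : family) (tau : forall w, 'S_(d w)) :
  asymp_null (fun w => u w - v w) ->
  asymp_null (fun w => perm_act (tau w) (u w) - perm_act (tau w) (v w)).
Proof. by move=> uv e /uv; apply: filterS => w; rewrite -(norm2_perm_act (tau w)). Qed.

Lemma asymp_null_trans (u v x : family) :
  asymp_null (fun w => u w - v w) -> asymp_null (fun w => v w - x w) ->
  asymp_null (fun w => u w - x w).
Proof.
move=> uv vx; apply: (asymp_null_dom ler01 ler01 uv vx).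
apply: nearW => w k; rewrite !tupleBE !mul1r -[u w k](subrK (v w k)) -addrA.
by rewrite addrK; exact: normcD_le.
Qed.

End AsymptoticallyNull.

(** * The asymptotic equalizer of two families of homomorphisms *)

Section CstarIntersection.
Variables (R : realType) (X : topologicalType).
Notation CX := (continuousType X R[i]).

Lemma Cstar_bigcap I (A : I -> set CX) :
  (forall i, unital_Cstar_subalgebra (A i)) ->
  unital_Cstar_subalgebra (\bigcap_i A i).
Proof.
move=> AC; split.
- by move=> i _; have [] := AC i.
- by move=> c f g fA gA i _; have [_ H _ _ _] := AC i; apply: H; [exact: fA|exact: gA].
- by move=> f g fA gA i _; have [_ _ H _ _] := AC i; apply: H; [exact: fA|exact: gA].
- by move=> f fA i _; have [_ _ _ H _] := AC i; apply: H; exact: fA.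
- move=> f fA i _; have [_ _ _ _ H] := AC i; apply: H => e /fA[g gA fg].
  by exists g => //; exact: gA.
Qed.

End CstarIntersection.

Section Equalizer.
Variables (R : realType) (X : topologicalType).
Notation CX := (continuousType X R[i]).
Notation normc := (@Normc.normc R).
Hypothesis cptX : compact [set: X].
Variables (T : Type) (F : set_system T) (FF : Filter F) (d : T -> nat).
Variables Th Th' : forall w, CX -> 'I_(d w) -> R[i].
Arguments Th : clear implicits.
Arguments Th' : clear implicits.
Hypothesis ThH : \forall w \near F, unital_hom (Th w).
Hypothesis Th'H : \forall w \near F, unital_hom (Th' w).

(** The functions on which the homomorphisms Th and Th' agree asymptotically
    along F. *)
Definition asymp_equalizer : set CX :=
  [set f | asymp_null F (fun w => Th w f - Th' w f)].

Lemma asymp_equalizer_Cstar : unital_Cstar_subalgebra asymp_equalizer.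
Proof.
split.
- move=> e e0; apply: filterS2 ThH Th'H => w hw hw'.
  apply: (@le_lt_trans _ _ 0) => //; apply: norm2_le_cst => // k.
  by rewrite tupleBE !unital_hom1// subrr Normc.normc0.
- move=> c f g f0 g0; apply: (asymp_null_dom FF (normc_ge0 c) ler01 f0 g0).
  apply: filterS2 ThH Th'H => w hw hw' k.
  rewrite tupleBE !unital_homL// mul1r.
  rewrite (_ : _ - _ = c * (Th w f - Th' w f) k + (Th w g - Th' w g) k).
    by rewrite -Normc.normcM; exact: normcD_le.
  by rewrite !tupleBE; ring.
- move=> f g f0 g0.
  apply: (asymp_null_dom FF (supnorm_ge0 g cptX) (supnorm_ge0 f cptX) f0 g0).
  apply: filterS2 ThH Th'H => w hw hw' k.
  rewrite tupleBE !unital_homM//.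
  have fk := unital_hom_norm_le hw' f k cptX.
  have gk := unital_hom_norm_le hw g k cptX.
  (* a b - a' b' = (a - a') b + a' (b - b'), with b and a' bounded *)
  rewrite (_ : _ - _ = (Th w f - Th' w f) k * Th w g k + Th' w f k * (Th w g - Th' w g) k).
    apply: le_trans (normcD_le _ _) _; rewrite !Normc.normcM.
    by apply: lerD; [rewrite mulrC|]; apply: ler_wpM2r => //; exact: normc_ge0.
  by rewrite !tupleBE; ring.
- move=> f f0; apply: (asymp_null_dom FF ler01 (lexx 0) f0 f0).
  apply: filterS2 ThH Th'H => w hw hw' k.
  by rewrite tupleBE !unital_hom_conj// -rmorphB mul1r mul0r addr0 normc_conj.
- (* closedness: f is e/8-close to some g in the equalizer, and both Th and
     Th' are contractive *)
  move=> f fA e e0.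
  have e8 : 0 < e / 8 by lra.
  have e4 : 0 < e / 4 by lra.
  have [g g0 fg] := fA _ e8.
  apply: filterS3 (g0 _ e4) ThH Th'H => w gw hw hw'.
  have s0 : 0 <= 2 * supnorm (f - g) by rewrite mulr_ge0 ?supnorm_ge0.
  have : norm2 (Th w f - Th' w f) <= 2 * (1 * norm2 (Th w g - Th' w g))
     + 2 * ((2 * supnorm (f - g)) * norm2 (fun _ : 'I_(d w) => 1 : R[i])).
    apply: norm2_dom => // k; rewrite Normc.normc1 mul1r mulr1.
    have fk := unital_hom_norm_le hw (f - g) k cptX.
    have gk := unital_hom_norm_le hw' (f - g) k cptX.
    rewrite (_ : (_ - _) k = (Th w g - Th' w g) k + (Th w (f - g) k - Th' w (f - g) k)).
      apply: le_trans (normcD_le _ _) _; rewrite lerD2l.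
      apply: le_trans (normcD_le _ _) _; rewrite normc_opp; lra.
    rewrite !unital_homB//.
    by rewrite !tupleBE; ring.
  have n1 : norm2 (fun _ : 'I_(d w) => 1 : R[i]) <= 1.
    by apply: norm2_le_cst => // k; rewrite Normc.normc1.
  have := norm2_ge0 (fun _ : 'I_(d w) => 1 : R[i]).
  move=> n0 H; apply: le_lt_trans H _; have := ler_wpM2l s0 n1; lra.
Qed.

End Equalizer.

(** * Sums with dyadic weights *)

Section DyadicSums.
Variable R : realType.
Implicit Type u : nat -> R.

Lemma dyadic_term_ge0 u n : (forall m, 0 <= u m) ->
  (0%R <= (2^-1 ^+ n.+1 * u n)%:E)%E.
Proof. by move=> u0; rewrite lee_fin mulr_ge0// exprn_ge0. Qed.

Lemma dyadic_term_le u n : (forall m, 0 <= u m) ->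
  ((2^-1 ^+ n.+1 * u n)%:E <= \sum_(0 <= m <oo) (2^-1 ^+ m.+1 * u m)%:E)%E.
Proof.
move=> u0.
apply: le_trans (@nneseries_lim_ge _ _ xpredT 0%N n.+1 _).
  rewrite big_nat_recr//= -[leLHS]add0e leeD2r// sume_ge0// => m _.
  exact: dyadic_term_ge0.
by move=> m _ _; exact: dyadic_term_ge0.
Qed.

Lemma dyadic_sum_le u (N : nat) (eta : R) : (forall n, 0 <= u n <= 2) ->
  0 <= eta -> (forall n, (n < N)%N -> u n <= eta) ->
  (\sum_(0 <= n <oo) (2^-1 ^+ n.+1 * u n)%:E <= (eta + 2 * 2^-1 ^+ N)%:E)%E.
Proof.
move=> u02 eta0 uN.
have u0 n : 0 <= u n by case/andP: (u02 n).
apply: lime_le; first by apply: is_cvg_nneseries => n _ _; exact: dyadic_term_ge0.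
apply: nearW => M; rewrite sumEFin lee_fin.
have c0 n : 0 <= (2^-1 : R) ^+ n by rewrite exprn_ge0.
(* the weights sum to 1 - 2^-M below M, and to 2^-N - 2^-M from N to M *)
suff : \sum_(0 <= n < M) 2^-1 ^+ n.+1 * u n <=
    eta * (1 - 2^-1 ^+ M) + 2 * (2^-1 ^+ N - 2^-1 ^+ maxn M N).
  move/le_trans; apply; have := mulr_ge0 eta0 (c0 M); have := c0 (maxn M N); lra.
elim: M => [|M IH].
  by rewrite big_nil max0n !subrr !mulr0 addr0.
rewrite big_nat_recr//=.
have [NM|MN] := leqP N M.
  rewrite (maxn_idPl NM) in IH; rewrite (maxn_idPl (leqW NM)).
  have /andP[_ uM] := u02 M; have := ler_wpM2l (c0 M.+1) uM.
  have := mulr_ge0 eta0 (c0 M.+1).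
  move: IH; rewrite (exprS _ M); lra.
rewrite (maxn_idPr (ltnW MN)) in IH; rewrite (maxn_idPr MN).
have := ler_wpM2l (c0 M.+1) (uN _ MN).
move: IH; rewrite (exprS _ M); lra.
Qed.

(** Dominated convergence for these sums. *)
Lemma dyadic_sum_near T (F : set_system T) (FF : Filter F) (u : T -> nat -> R) :
  (\forall w \near F, forall n, 0 <= u w n <= 2) ->
  (forall n e, 0 < e -> \forall w \near F, u w n < e) ->
  forall e, 0 < e ->
  \forall w \near F, (\sum_(0 <= n <oo) (2^-1 ^+ n.+1 * u w n)%:E < e%:E)%E.
Proof.
move=> u02 u0 e e0.
have e4 : 0 < e / 4 by lra.
have [N _ /(_ N (leqnn N)) /= NE] := near_infty_natSinv_expn_lt (PosNum e4).
have u0N : \forall w \near F, forall i : 'I_N, u w i < e / 4.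
  by apply: filter_forall => i; exact: u0.
apply: filterS2 u02 u0N => w uw uwN.
apply: (@le_lt_trans _ _ (e / 4 + 2 * 2^-1 ^+ N)%:E).
  apply: dyadic_sum_le => //; first exact: ltW.
  by move=> n nN; have := ltW (uwN (Ordinal nN)).
by rewrite lte_fin; move: NE; rewrite div1r exprVn; lra.
Qed.

End DyadicSums.

(** * Monotonicity of the ingredients of the entropy *)

Section Monotonicity.
Variable R : realType.

Lemma limn_esup_le (u v : nat -> \bar R) :
  (\forall i \near \oo, (u i <= v i)%E) -> (limn_esup u <= limn_esup v)%E.
Proof.
move=> uv; rewrite /limn_esup !limf_esupE; apply: le_ereal_inf_tmp => _ [V Voo <-].
apply: (@le_trans _ _ (ereal_sup [set u i | i in V `&` [set i | (u i <= v i)%E]])).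
  apply: ereal_inf_lbound.
  by exists (V `&` [set i | (u i <= v i)%E]) => //; exact: filterI.
apply: ge_ereal_sup => _ [i [Vi uvi] <-]; apply: le_trans uvi _.
by apply: ereal_sup_ubound; exists i.
Qed.

Lemma max_separated_ge0 (T : Type) (e : R) (Y : set T) (r : T -> T -> \bar R) :
  (0 <= max_separated e Y r)%E.
Proof.
apply: ereal_sup_ubound; exists 0%N => //; exists set0.
split; [exact: sub0set|by rewrite II0; exact: card_eq00|by []].
Qed.

Lemma le_max_separated (T : Type) (e e' : R) (Y Y' : set T) (r r' : T -> T -> \bar R) :
  Y `<=` Y' ->
  (forall x y, Y x -> Y y -> (e%:E < r x y)%E -> (e'%:E < r' x y)%E) ->
  (max_separated e Y r <= max_separated e' Y' r')%E.
Proof.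
move=> YY' rr'; apply: le_ereal_sup => _ [n [A [AY An sep]] <-].
exists n => //; exists A; split => //; first exact: subset_trans YY'.
by move=> x y Ax Ay xy; apply: rr'; [exact: AY|exact: AY|exact: sep].
Qed.

Lemma le_lne (x y : \bar R) : (0 <= x)%E -> (x <= y)%E -> (lne x <= lne y)%E.
Proof.
by move=> x0 xy; rewrite lee_lne// in_itv/= ?x0 ?(le_trans x0 xy) leey.
Qed.

End Monotonicity.

(** * Asymptotic behaviour of approximately equivariant homomorphisms *)

Section Approximation.
Variables (R : realType) (G : groupType) (X : topologicalType).
Notation CX := (continuousType X R[i]).
Notation normc := (@Normc.normc R).
Variables (act : G -> continuousType X X) (d : nat -> nat).
Variable sigma : forall i : nat, G -> 'S_(d i).
Arguments sigma : clear implicits.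
Hypothesis cptX : compact [set: X].
Hypothesis actP : continuous_action act.
Hypothesis sigmaP : asymp_multiplicative R sigma.

Lemma alpha_comp s t (f : CX) : alpha act s (alpha act t f) = alpha act (s * t)%g f.
Proof.
apply/continuousEP => x; rewrite /alpha /= invgM.
by rewrite (actP.2 (t^-1)%g).
Qed.

Lemma unital_hom_alpha n (phi : CX -> 'I_n -> R[i]) s :
  unital_hom phi -> unital_hom (fun f => phi (alpha act s f)).
Proof.
move=> phiH; split; [move=> c f g | split=> [|f g]].
- by rewrite -phiH.1; congr phi; apply/continuousEP.
- by rewrite -[RHS](fst phiH.2); congr phi; apply/continuousEP.
- by rewrite -(snd phiH.2); congr phi; apply/continuousEP.
Qed.

Lemma unital_hom_perm n (phi : CX -> 'I_n -> R[i]) (s : 'S_n) :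
  unital_hom phi -> unital_hom (fun f => perm_act s (phi f)).
Proof.
move=> phiH; split; [move=> c f g | split=> [|f g]].
- by rewrite phiH.1.
- by rewrite (fst phiH.2).
- by rewrite (snd phiH.2).
Qed.

Lemma norm2_diff_le2 n (f : CX) (phi psi : CX -> 'I_n -> R[i]) :
  real_unit_ball f -> unital_hom phi -> unital_hom psi ->
  0 <= norm2 (phi f - psi f) <= 2.
Proof.
move=> [_ f1] phiH psiH; rewrite norm2_ge0 /=; apply: norm2_le_cst => // k.
rewrite tupleBE; apply: le_trans (normcD_le _ _) _; rewrite normc_opp.
have := unital_hom_norm_le phiH f k cptX; have := unital_hom_norm_le psiH f k cptX.
lra.
Qed.

Section Generating.
Variable p : nat -> CX.
Hypothesis pgen : dynamically_generating act (range p).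

Lemma approx_homS (F F' : set G) (delta delta' : R) n (tau : G -> 'S_n) :
  F `<=` F' -> delta' <= delta ->
  approx_hom act p F' delta' tau `<=` approx_hom act p F delta tau.
Proof.
move=> FF' dd phi [phiH phiF]; split => // s /FF' /phiF /lt_le_trans; apply.
by rewrite lee_fin.
Qed.

(** The sets of pairs (i, phi) with i >= N and phi in Hom(p, F, delta, sigma_i),
    for F finite and nonempty, delta > 0 and N arbitrary, form a base of this
    filter. *)
Definition approx_filter : set_system {i : nat & CX -> 'I_(d i) -> R[i]} :=
  filter_from
    [set b : set G * R * nat | [/\ finite_set b.1.1, b.1.1 !=set0 & 0 < b.1.2]]
    (fun b => [set w | (b.2 <= projT1 w)%N /\
       approx_hom act p b.1.1 b.1.2 (sigma (projT1 w)) (projT2 w)]).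

(** The same for triples (i, phi, psi), with both phi and psi in
    Hom(p, F, delta, sigma_i) and rho_p(phi, psi) <= eps, for eps > 0. *)
Definition close_filter :
    set_system {i : nat & ((CX -> 'I_(d i) -> R[i]) * (CX -> 'I_(d i) -> R[i]))%type} :=
  filter_from
    [set b : set G * R * nat * R |
       [/\ finite_set b.1.1.1, b.1.1.1 !=set0, 0 < b.1.1.2 & 0 < b.2]]
    (fun b => [set w | [/\ (b.1.2 <= projT1 w)%N,
       approx_hom act p b.1.1.1 b.1.1.2 (sigma (projT1 w)) (projT2 w).1,
       approx_hom act p b.1.1.1 b.1.1.2 (sigma (projT1 w)) (projT2 w).2 &
       (rho p (projT2 w).1 (projT2 w).2 <= b.2%:E)%E]]).

#[global] Instance approx_filter_filter : Filter approx_filter.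
Proof.
apply: filter_from_filter.
  by exists ([set 1%g], 1, 0%N); split => //=; exists 1%g.
move=> [[F1 e1] n1] [[F2 e2] n2] [/= fF1 F10 e10] [/= fF2 F20 e20].
exists (F1 `|` F2, Num.min e1 e2, maxn n1 n2).
  split => /=; [by rewrite finite_setU|by have [x] := F10; exists x; left|].
  by rewrite lt_min e10.
move=> [i phi] /= []; rewrite geq_max => /andP[n1i n2i] H.
have m1 : Num.min e1 e2 <= e1 by rewrite ge_min lexx.
have m2 : Num.min e1 e2 <= e2 by rewrite ge_min lexx orbT.
split; split => //; [exact: (approx_homS (@subsetUl _ F1 F2) m1 H)|].
exact: (approx_homS (@subsetUr _ F1 F2) m2 H).
Qed.

#[global] Instance close_filter_filter : Filter close_filter.
Proof.
apply: filter_from_filter.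
  by exists ([set 1%g], 1, 0%N, 1); split => //=; exists 1%g.
move=> [[[F1 e1] n1] r1] [[[F2 e2] n2] r2] [/= fF1 F10 e10 r10] [/= fF2 F20 e20 r20].
exists (F1 `|` F2, Num.min e1 e2, maxn n1 n2, Num.min r1 r2).
  split => /=; [by rewrite finite_setU|by have [x] := F10; exists x; left| |].
    by rewrite lt_min e10.
  by rewrite lt_min r10.
move=> [i [phi psi]] /= []; rewrite geq_max => /andP[n1i n2i] H1 H2 r.
have r1' : (rho p phi psi <= r1%:E)%E by rewrite (le_trans r)// lee_fin ge_min lexx.
have r2' : (rho p phi psi <= r2%:E)%E by rewrite (le_trans r)// lee_fin ge_min lexx orbT.
have m1 : Num.min e1 e2 <= e1 by rewrite ge_min lexx.
have m2 : Num.min e1 e2 <= e2 by rewrite ge_min lexx orbT.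
have S1 := approx_homS (@subsetUl _ F1 F2) m1.
have S2 := approx_homS (@subsetUr _ F1 F2) m2.
by split; split => //=; [exact: S1 H1|exact: S1 H2|exact: S2 H1|exact: S2 H2].
Qed.

Lemma approx_filter_hom : \forall w \near approx_filter, unital_hom (projT2 w).
Proof. by exists ([set 1%g], 1, 0%N) => [|w [_ []]]//; split => //=; exists 1%g. Qed.

Lemma approx_filter_tag (P : nat -> Prop) :
  (\forall i \near \oo, P i) -> \forall w \near approx_filter, P (projT1 w).
Proof.
move=> [N _ NP]; exists ([set 1%g], 1, N); first by split => //=; exists 1%g.
by move=> w [/= Nw _]; exact: NP.
Qed.

Lemma close_filter_approx P : approx_filter P ->
  \forall w \near close_filter,
    P (existT _ (projT1 w) (projT2 w).1) /\ P (existT _ (projT1 w) (projT2 w).2).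
Proof.
move=> [[[F e] n] [/= fF F0 e0] H]; exists (F, e, n, 1) => //.
by move=> [i [phi psi]] [/= ni H1 H2 _]; split; apply: H.
Qed.

(** This is where the asymptotic multiplicativity of sigma enters. *)
Lemma defect_null (f : CX) s t : asymp_null approx_filter (fun w =>
  perm_act (sigma (projT1 w) (s * t)%g) (projT2 w f) -
  perm_act (sigma (projT1 w) s) (perm_act (sigma (projT1 w) t) (projT2 w f))).
Proof.
move=> e e0; set c := supnorm f; have c0 : 0 <= c by exact: supnorm_ge0.
pose e' := e ^+ 2 / ((2 * c) ^+ 2 + 1).
have D0 : 0 < (2 * c) ^+ 2 + 1 by rewrite ltr_wpDl ?sqr_ge0.
have e'0 : 0 < e' by rewrite divr_gt0// exprn_gt0.
have /cvgrPdist_lt /(_ _ e'0)/approx_filter_tag := sigmaP s t.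
move: approx_filter_hom; apply: filterS2 => -[i phi] /= phiH dist_lt.
rewrite -(@ltr_pXn2r _ 2)// ?nnegrE ?norm2_ge0 ?(ltW e0)//.
have fc k : normc (phi f k) <= c by exact: unital_hom_norm_le.
apply: le_lt_trans (perm_act_defect (sigma i (s * t)%g) (sigma i s) (sigma i t) c0 fc) _.
apply: (@le_lt_trans _ _ (e' * (2 * c) ^+ 2)).
  by rewrite ler_wpM2r ?sqr_ge0// (le_trans (ler_norm _))// ltW.
have -> : e ^+ 2 = e' * ((2 * c) ^+ 2 + 1) by rewrite /e' divfK// gt_eqF.
by rewrite ltr_pM2l// ltrDl.
Qed.

(** Approximate equivariance on the sequence p propagates to all of C(X). *)
Lemma approx_filter_equivariant (f : CX) s :
  asymp_null approx_filter (fun w =>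
    projT2 w (alpha act s f) - perm_act (sigma (projT1 w) s) (projT2 w f)).
Proof.
pose A s := asymp_equalizer approx_filter
  (fun w g => projT2 w (alpha act s g))
  (fun w g => perm_act (sigma (projT1 w) s) (projT2 w g)).
have AC t : unital_Cstar_subalgebra (A t).
  apply: asymp_equalizer_Cstar => //; move: approx_filter_hom; apply: filterS => w.
    exact: unital_hom_alpha.
  exact: unital_hom_perm.
suff /seteqP[_ /(_ f I)] : \bigcap_t A t = [set: CX] by move/(_ s I).
apply: pgen.
- exact: Cstar_bigcap.
- (* phi (alpha_s' alpha_t g) = phi (alpha_s't g) is close to sigma_s't (phi g),
     then to sigma_s' (sigma_t (phi g)), then to sigma_s' (phi (alpha_t g)) *)
  move=> t g gA s' _.
  suff H : asymp_null approx_filter (fun w =>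
      projT2 w (alpha act (s' * t)%g g) -
      perm_act (sigma (projT1 w) s') (projT2 w (alpha act t g))).
    by move=> e /H; apply: filterS => w; rewrite alpha_comp.
  apply: (asymp_null_trans approx_filter_filter (gA (s' * t)%g I)).
  apply: (asymp_null_trans approx_filter_filter (defect_null g s' t)).
  apply: (asymp_null_perm approx_filter_filter).
  exact: (asymp_nullN approx_filter_filter (gA t I)).
- (* the n-th term of the sum defining Hom(p, {s'}, delta, sigma_i) *)
  move=> _ [n _ <-] s' _ e e0.
  have e'0 : 0 < 2^-1 ^+ n.+1 * e by rewrite mulr_gt0// exprn_gt0.
  exists ([set s'], 2^-1 ^+ n.+1 * e, 0%N); first by split => //=; exists s'.
  move=> [i phi] [_ [_ /(_ s' erefl)]] /=.
  move/(le_lt_trans (dyadic_term_le n (fun m => norm2_ge0 _))).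
  by rewrite lte_fin ltr_pM2l// exprn_gt0.
Qed.

(** Closeness on the sequence p propagates to all of C(X). *)
Lemma close_filter_close (f : CX) :
  asymp_null close_filter (fun w => (projT2 w).1 f - (projT2 w).2 f).
Proof.
pose A := asymp_equalizer close_filter (fun w => (projT2 w).1) (fun w => (projT2 w).2).
suff /seteqP[_ /(_ f I)] : A = [set: CX] by [].
have hom12 := close_filter_approx approx_filter_hom.
apply: pgen.
- apply: asymp_equalizer_Cstar => //; move: hom12; apply: filterS => w [].
    by [].
  by [].
- (* phi (alpha_s g), sigma_s (phi g), sigma_s (psi g) and psi (alpha_s g) are
     successively close *)
  move=> s g gA.
  have equi e : 0 < e -> _ := fun e0 => close_filter_approx (approx_filter_equivariant g s e0).
  apply: (@asymp_null_trans _ _ _ _ _ _ (fun w => perm_act (sigma (projT1 w) s) ((projT2 w).1 g))).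
    by move=> e /equi; apply: filterS => w [].
  apply: (@asymp_null_trans _ _ _ _ _ _ (fun w => perm_act (sigma (projT1 w) s) ((projT2 w).2 g))).
    exact: asymp_null_perm.
  by apply: asymp_nullN => e /equi; apply: filterS => w [].
- move=> _ [n _ <-] e e0.
  have e'0 : 0 < 2^-1 ^+ n.+1 * (e / 2) by rewrite mulr_gt0 ?exprn_gt0// divr_gt0.
  exists ([set 1%g], 1, 0%N, 2^-1 ^+ n.+1 * (e / 2)).
    by split => //=; exists 1%g.
  move=> [i [phi psi]] [_ _ _] /=.
  move/(le_trans (dyadic_term_le n (fun m => norm2_ge0 _))).
  rewrite lee_fin ler_pM2l ?exprn_gt0// => /le_lt_trans; apply; lra.
Qed.

End Generating.

(** * Comparison of two sequences *)

(** Being approximately equivariant on p forces the same on any sequence q in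
    the unit ball. *)
Lemma approx_filter_approx_hom (p q : nat -> CX) (F : set G) (delta : R) :
  dynamically_generating act (range p) -> (forall n, real_unit_ball (q n)) ->
  finite_set F -> 0 < delta ->
  \forall w \near approx_filter p,
    approx_hom act q F delta (sigma (projT1 w)) (projT2 w).
Proof.
move=> pgen q1 fF delta0.
pose u s (w : {i : nat & CX -> 'I_(d i) -> R[i]}) n :=
  norm2 (projT2 w (alpha act s (q n)) -
         perm_act (sigma (projT1 w) s) (projT2 w (q n))).
pose S s := [set w |
  (\sum_(0 <= n <oo) (2^-1 ^+ n.+1 * u s w n)%:E < delta%:E)%E].
have DS : approx_filter p (\bigcap_(s in F) S s).
  have /finite_fsetP[D ->] := fF; apply: filter_bigI => s _.
  apply: (dyadic_sum_near (approx_filter_filter p) _ _ delta0 (u := u s)).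
    apply: filterS (approx_filter_hom p) => w wH n.
    apply: (@norm2_diff_le2 _ (q n) (fun f => projT2 w (alpha act s f))
      (fun f => perm_act (sigma (projT1 w) s) (projT2 w f))) => //.
      exact: unital_hom_alpha.
    exact: unital_hom_perm.
  by move=> n e e0; exact: approx_filter_equivariant.
by apply: filterS2 (approx_filter_hom p) DS => w wH wS; split.
Qed.

(** For approximately equivariant homomorphisms, rho_p controls rho_q. *)
Lemma close_filter_rho (p q : nat -> CX) (eps : R) :
  dynamically_generating act (range p) -> (forall n, real_unit_ball (q n)) ->
  0 < eps ->
  \forall w \near close_filter p,
    (rho q (projT2 w).1 (projT2 w).2 < eps%:E)%E.
Proof.
move=> pgen q1; apply: dyadic_sum_near.
  have := close_filter_approx (approx_filter_hom p).
  by apply: filterS => w [w1 w2] n; exact: norm2_diff_le2.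
by move=> n e e0; exact: close_filter_close.
Qed.

(** The scale eps' obtained from eps does not depend on F and delta, as the
    order of sup and inf in the definition of the entropy requires. *)
Lemma sofic_entropy_le (p q : nat -> CX) :
  (forall n, real_unit_ball (p n)) -> dynamically_generating act (range p) ->
  (forall n, real_unit_ball (q n)) -> dynamically_generating act (range q) ->
  (sofic_entropy act sigma q <= sofic_entropy act sigma p)%E.
Proof.
move=> p1 pgen q1 qgen.
apply: ge_ereal_sup => _ [eps eps0 <-].
have [[[[F0 delta0] N0] eps'] [/= fF0 F00 d00 eps'0] close] :=
  close_filter_rho pgen q1 eps0.
apply: (@le_trans _ _ _ _ _ _ (ereal_sup_ubound _)); last first.
  by exists eps'.
apply: le_ereal_inf_tmp => _ [F [fF FN0] <-].
apply: le_ereal_inf_tmp => _ [delta /= delta_gt0 <-].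
have fFF0 : finite_set (F `|` F0) by rewrite finite_setU.
have dd0 : 0 < Num.min delta delta0 by rewrite lt_min delta_gt0.
have [[[F' delta'] N] [/= fF' F'0 d'0] sub] :=
  approx_filter_approx_hom qgen p1 fFF0 dd0.
apply: (le_trans (ereal_inf_lbound _)); first by exists F'.
apply: (le_trans (ereal_inf_lbound _)); first by exists delta'.
apply: limn_esup_le; exists (maxn N N0); first exact: I.
move=> i le_i; have /andP[Ni N0i] : (N <= i)%N && (N0 <= i)%N by rewrite -geq_max.
apply: lee_wpmul2l; first by rewrite lee_fin invr_ge0.
apply: le_lne; first exact: max_separated_ge0.
have sub' phi : approx_hom act q F' delta' (sigma i) phi ->
    approx_hom act p (F `|` F0) (Num.min delta delta0) (sigma i) phi.
  by move=> phiH; apply: (sub (existT _ i phi)).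
apply: le_max_separated.
  move=> phi /sub'; apply: approx_homS; first exact: subsetUl.
  by rewrite ge_min lexx.
have S2 : approx_hom act p (F `|` F0) (Num.min delta delta0) (sigma i) `<=`
    approx_hom act p F0 delta0 (sigma i).
  by apply: approx_homS; [exact: subsetUr|rewrite ge_min lexx orbT].
move=> phi psi /sub'/S2 phiH /sub'/S2 psiH; rewrite !ltNge.
apply: contra => rle.
exact/ltW/(close (existT _ i (phi, psi))).
Qed.

End Approximation.

Theorem theorem4p5 (R : realType) (G : groupType) (X : topologicalType)
    (act : G -> continuousType X X)
    (d : nat -> nat) (sigma : forall i : nat, G -> 'S_(d i))
    (p q : nat -> continuousType X R[i]) :
  countable [set: G] -> sofic R G ->
  compact [set: X] -> metrizable R X ->
  continuous_action act ->
  sofic_approximation R sigma ->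
  (forall n, real_unit_ball (p n)) -> dynamically_generating act (range p) ->
  (forall n, real_unit_ball (q n)) -> dynamically_generating act (range q) ->
  sofic_entropy act sigma q = sofic_entropy act sigma p.
Proof.
move=> _ _ cptX _ actP [_ sigmaP _] p1 pgen q1 qgen.
by apply/le_anti/andP; split; exact: sofic_entropy_le.
Qed.
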